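(* Let $f:\mathbb{Z}\setminus\{0\}\to\mathbb{C}$ satisfy $f(m)=o(1)$ as $|m|\to\infty$, let $k$ be a positive integer and $a\in\mathbb{R}\setminus\{0\}$. For integers $0\le l\le j$ put $S(j,l):=\sum_{(r_0,\dots,r_l)\in\mathbb{N}_0^{l+1},\ r_0+\cdots+r_l=j-l}\prod_{h=0}^{l}(2h+1)^{2r_h}$. Then $$\sum_{m,n\in\mathbb{Z},\,m\neq 0}\frac{f(m)(-1)^n}{(m+a(2n+1)i)^{2k}}=\frac{\pi^{2k}i}{(2a)^{2k}(2k-1)!}\sum_{l=0}^{k-1}(-1)^{l-1}(2l+1)!\,S(k-1,l)\sum_{m=1}^\infty\frac{\big(f(m)-f(-m)\big)\sinh(m\pi/2a)}{\cosh^{2l+2}(m\pi/2a)},$$ $$\sum_{m,n\in\mathbb{Z},\,m\neq 0}\frac{f(m)(-1)^n}{(m+a(2n+1)i)^{2k-1}}=\frac{\pi^{2k-1}i}{(2a)^{2k-1}(2k-2)!}\sum_{l=0}^{k-1}(-1)^{l-1}(2l)!\,S(k-1,l)\sum_{m=1}^\infty\frac{f(m)+f(-m)}{\cosh^{2l+1}(m\pi/2a)}.$$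
   Context: $i=\sqrt{-1}$, $\mathbb{N}_0$ is the set of nonnegative integers; $m\pi/2a$ means $m\pi/(2a)$. A double sum $\sum_{m,n\in\mathbb{Z},\,m\neq0}F(m,n)$ means the iterated sum $\sum_{m\in\mathbb{Z}\setminus\{0\}}\lim_{N\to\infty}\sum_{n=-N}^{N}F(m,n)$ (for exponent at least $2$ the inner sum converges absolutely). *)

(* Defs.v *)
From mathcomp Require Export ssreflect ssrfun ssrbool eqtype ssrnat seq fintype finfun bigop.
From Stdlib Require Export Reals ZArith.
From Coquelicot Require Export Coquelicot.

(* f(m) = o(1) as |m| -> oo, for f defined on Z \ {0}; the value f 0 of the
   total function is never used. *)
Definition little_o1 (f : Z -> C) : Prop :=
  forall eps : R, (0 < eps)%R ->
    exists M : Z, forall m : Z,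
      m <> 0%Z -> (M < Z.abs m)%Z -> (Cmod (f m) < eps)%R.

(* r_0 + ... + r_l = j - l forces r_h <= j - l, so letting every r_h range over
   {0, ..., j - l} loses no tuple.  Meant for l <= j (subtraction on nat). *)
Definition Scoef (j l : nat) : nat :=
  (\sum_(r : {ffun 'I_l.+1 -> 'I_(j - l).+1} | \sum_(h < l.+1) r h == j - l)
     \prod_(h < l.+1) expn (2 * h + 1) (2 * r h))%nat.

Definition is_sum_sym (F : Z -> C) (s : C) : Prop :=
  filterlim
    (fun N : nat => sum_n (fun i : nat => F (Z.of_nat i - Z.of_nat N)%Z) (2 * N)%nat)
    eventually (locally s).

(* Unordered sum over Z \ {0}: both half-series converge absolutely, and s is
   the sum of their values. *)
Definition is_sum_nonzero (g : Z -> C) (s : C) : Prop :=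
  ex_series (fun m : nat => Cmod (g (Z.of_nat m.+1))) /\
  ex_series (fun m : nat => Cmod (g (- Z.of_nat m.+1)%Z)) /\
  exists p q : C,
    is_series (fun m : nat => g (Z.of_nat m.+1)) p /\
    is_series (fun m : nat => g (- Z.of_nat m.+1)%Z) q /\
    s = (p + q)%C.

Definition is_iterated_sum (F : Z -> Z -> C) (s : C) : Prop :=
  exists g : Z -> C,
    (forall m : Z, m <> 0%Z -> is_sum_sym (F m) (g m)) /\ is_sum_nonzero g s.

(* Componentwise sum of a complex series; meaningful when the series converges. *)
Definition CSeries (u : nat -> C) : C :=
  (Series (fun n => Re (u n)), Series (fun n => Im (u n))).

Definition even_rhs_term (f : Z -> C) (a : R) (l m : nat) : C :=
  ((f (Z.of_nat m) - f (- Z.of_nat m)%Z) * RtoC (sinh (INR m * PI / (2 * a)))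
   / RtoC (cosh (INR m * PI / (2 * a)) ^ (2 * l + 2)%nat))%C.

Definition odd_rhs_term (f : Z -> C) (a : R) (l m : nat) : C :=
  ((f (Z.of_nat m) + f (- Z.of_nat m)%Z)
   / RtoC (cosh (INR m * PI / (2 * a)) ^ (2 * l + 1)%nat))%C.

(* Main.v *)
(** For [x] real, pairing [n] with [-n-1] turns the sum of [(-1)^n / (x + a(2n+1)i)]
into the partial fraction expansion of [sech]: it equals [-(pi i / 2a) sech (pi x / 2a)].
That expansion is obtained from the Dirichlet kernel [sum_n cos((2n+1)u)], by comparing
the integrals of [cosh(tu)] and of [1] against it on [[0, pi/2]] (the second one is
Leibniz' series). Differentiating in [x] gives all higher exponents. Since
[(sech^p)'' = p^2 sech^p - p(p+1) sech^(p+2)], the coefficients of the even derivatives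
of [sech] on the odd powers of [sech] satisfy the recursion
[S(j+1,l) = (2l+1)^2 S(j,l) + S(j,l-1)] of the complete homogeneous symmetric
polynomials in [1^2, 3^2, ..., (2l+1)^2]. The sum over [m] converges geometrically. *)

Require Import Defs.
From Stdlib Require Import Lra Lia.
From mathcomp Require nmodule ssralg poly.
From mathcomp Require Import zify.

(** * The recursion for the numbers S(j,l) *)

Module ScoefTheory.
Import nmodule ssralg poly GRing.Theory.
Local Open Scope ring_scope.

(* Complete homogeneous symmetric polynomial of degree [d] in the first [l] of the
   variables 1^2, 3^2, 5^2, ... *)
Fixpoint hsym (l d : nat) : nat :=
  if l is l'.+1 then
    (\sum_(i < d.+1) hsym l' i * expn (2 * l' + 1) (2 * (d - i)))%nat
  else (d == 0)%nat.

(* Generating polynomial of [hsym l], whose factors are geometric series cut at degree [B]. *)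
Definition hpoly (l B : nat) : {poly nat} :=
  \prod_(h < l) \poly_(r < B.+1) expn (2 * h + 1) (2 * r).

(** The Cauchy product adds one factor at a time; cutting the geometric series at [B] leaves the
    coefficients of degree at most [B] unchanged. *)
Lemma coef_hpoly (l B d : nat) : (d <= B)%nat -> (hpoly l B)`_d = hsym l d.
Proof.
elim: l d => [|l IHl] d hd; rewrite /hpoly.
  by rewrite big_ord0 coef1 /=; case: d hd.
rewrite big_ord_recr coefM /=.
apply: eq_bigr => i _; rewrite IHl; last by have := ltn_ord i; lia.
rewrite coef_poly ifT //; lia.
Qed.

(** Distributing the product of sums over choice functions turns the coefficient of X^(j-l) in
    [hpoly] into the sum over exponent tuples that defines [Scoef]. *)
Lemma Scoef_hsym (j l : nat) : Scoef j l = hsym l.+1 (j - l).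
Proof.
rewrite -(coef_hpoly _ (j - l)) // /hpoly.
under eq_bigr do rewrite poly_def.
rewrite bigA_distr_bigA /= coef_sum /Scoef big_mkcond /=.
apply: eq_bigr => r _.
have -> : \prod_(h < l.+1) (expn (2 * h + 1) (2 * r h) *: 'X^(r h)) =
  (\prod_(h < l.+1) expn (2 * h + 1) (2 * r h)) *:
    'X^(\sum_(h < l.+1) r h)%nat :> {poly nat}.
  by rewrite scaler_prod prodrXr.
rewrite coefZ coefXn eq_sym.
by case: eqP => _; rewrite /= ?mulr1 ?mulr0.
Qed.


(** Monomials of degree d+1 either contain the last variable (2l+1)^2, which factors out, or avoid
    it; the latter are the term [i = d.+1] of the sum. *)
Lemma hsymS (l d : nat) :
  hsym l.+1 d.+1 = (expn (2 * l + 1) 2 * hsym l.+1 d + hsym l d.+1)%nat.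
Proof.
rewrite /= big_ord_recr /= subnn muln0 expn0 muln1; congr addn.
rewrite big_distrr /=; apply: eq_bigr => i _.
rewrite [RHS]mulnCA -expnD; congr (_ * expn _ _)%nat.
by have := ltn_ord i; lia.
Qed.

Lemma Scoef_diag (j : nat) : Scoef j j = 1%nat.
Proof.
rewrite Scoef_hsym subnn; elim: j.+1 => [//|l IHl] /=.
by rewrite big_ord1 IHl subnn muln0.
Qed.

Lemma Scoef_0 (j : nat) : Scoef j.+1 0 = Scoef j 0.
Proof. by rewrite !Scoef_hsym !subn0 hsymS addn0 mul1n. Qed.

Lemma ScoefS (j l : nat) : (l < j)%nat ->
  Scoef j.+1 l.+1 = (expn (2 * l.+1 + 1) 2 * Scoef j l.+1 + Scoef j l)%nat.
Proof.
move=> hl; rewrite !Scoef_hsym.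
(* Here [l < j] enters: the subtraction must not truncate, so that the degree is a successor. *)
have -> : (j.+1 - l.+1 = (j - l.+1).+1)%nat by lia.
by rewrite hsymS; congr (_ + hsym _ _)%nat; lia.
Qed.

End ScoefTheory.

Local Open Scope R_scope.

(** * Elementary bounds for cosh, sinh and sin *)

Lemma Rabs_exp_half (y : R) : Rabs (exp y / 2) + Rabs (exp (- y) / 2) <= exp (Rabs y).
Proof.
have e1 : exp y <= exp (Rabs y).
  by case: (Rle_lt_or_eq_dec _ _ (Rle_abs y)) => [/exp_increasing|<-]; lra.
have e2 : exp (- y) <= exp (Rabs y).
  have := Rle_abs (- y); rewrite Rabs_Ropp.
  by case/Rle_lt_or_eq_dec => [/exp_increasing|<-]; lra.
have := exp_pos y; have := exp_pos (- y) => h1 h2.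
rewrite (Rabs_pos_eq (exp y / 2)) ?(Rabs_pos_eq (exp (- y) / 2)); lra.
Qed.

Lemma Rabs_cosh_le (y : R) : Rabs (cosh y) <= exp (Rabs y).
Proof.
apply: Rle_trans (Rabs_exp_half y).
have -> : cosh y = exp y / 2 + exp (- y) / 2 by rewrite /cosh; field.
exact: Rabs_triang.
Qed.

Lemma Rabs_sinh_le (y : R) : Rabs (sinh y) <= exp (Rabs y).
Proof.
apply: Rle_trans (Rabs_exp_half y).
have -> : sinh y = exp y / 2 + - (exp (- y) / 2) by rewrite /sinh; field.
by rewrite -(Rabs_Ropp (exp (- y) / 2)); exact: Rabs_triang.
Qed.

Lemma exp_le (x y : R) : x <= y -> exp x <= exp y.
Proof. by case/Rle_lt_or_eq_dec => [/exp_increasing|->]; lra. Qed.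

Lemma MVT_bound (g dg : R -> R) (x y K : R) : x < y ->
  (forall c, x <= c <= y -> is_derive g c (dg c)) ->
  (forall c, x < c < y -> Rabs (dg c) <= K) ->
  Rabs (g y - g x) <= K * (y - x).
Proof.
move=> hxy hd hK.
have [c hc|c [-> hc]] := MVT_cor2 g dg x y hxy.
  by apply/is_derive_Reals; exact: hd.
rewrite Rabs_mult (Rabs_pos_eq (y - x)); last lra.
by apply: Rmult_le_compat_r; [lra | exact: hK].
Qed.

Lemma Rabs_cosh_sub1_le (t u : R) : 0 < u <= 1 ->
  Rabs (cosh (t * u) - 1) <= Rabs t * exp (Rabs t) * u.
Proof.
move=> hu.
have := MVT_bound (fun u => cosh (t * u)) (fun u => t * sinh (t * u)) 0 u
  (Rabs t * exp (Rabs t)) (proj1 hu).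
rewrite Rmult_0_r cosh_0 Rminus_0_r; apply.
  by move=> c _; auto_derive => //; ring.
move=> c hc; rewrite Rabs_mult; apply: Rmult_le_compat_l; first exact: Rabs_pos.
apply: Rle_trans (Rabs_sinh_le _) (exp_le _ _ _).
rewrite Rabs_mult -[X in _ <= X]Rmult_1_r; apply: Rmult_le_compat_l; first exact: Rabs_pos.
rewrite Rabs_pos_eq; lra.
Qed.

Lemma sin_ge_half (u : R) : 0 < u <= 1 -> u / 2 <= sin u.
Proof.
move=> hu; have pi3 := PI2_3_2.
have [c hc|c [hc1 hc2]] := MVT_cor2 sin cos 0 u (proj1 hu).
  exact: derivable_pt_lim_sin.
rewrite sin_0 !Rminus_0_r in hc1; rewrite hc1.
(* Since 1 < PI/3, the cosine stays above 1/2 on (0, 1). *)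
have : cos (PI / 3) < cos c by apply: cos_decreasing_1; lra.
by rewrite cos_PI3; nra.
Qed.

(** * The Dirichlet kernel and the partial fractions of sech *)

Definition dirichlet (N : nat) (u : R) : R :=
  sum_n (fun n => cos ((2 * INR n + 1) * u)) N.

(** Telescoping: 2 sin u cos((2n+1)u) = sin((2n+2)u) - sin(2nu). *)
Lemma dirichlet_sin (N : nat) (u : R) :
  dirichlet N u * (2 * sin u) = sin (2 * INR N.+1 * u).
Proof.
rewrite /dirichlet; elim: N => [|N IHN].
  rewrite sum_O /= !Rmult_1_r Rmult_0_r Rplus_0_l Rmult_1_l sin_2a; ring.
rewrite sum_Sn; change plus with Rplus; rewrite Rmult_plus_distr_r IHN !S_INR.
have -> : 2 * (INR N + 1 + 1) * u = (2 * (INR N + 1) + 1) * u + u by ring.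
have -> : 2 * (INR N + 1) * u = (2 * (INR N + 1) + 1) * u - u by ring.
rewrite sin_plus sin_minus; ring.
Qed.

(** The antiderivative of cosh(tu) cos((2n+1)u) that vanishes at 0. At u = PI/2 its second term
    drops out, which leaves the n-th summand of the sech expansion times cosh(t PI/2). *)
Definition prim (t : R) (n : nat) (u : R) : R :=
  ((2 * INR n + 1) * sin ((2 * INR n + 1) * u) * cosh (t * u)
   + t * cos ((2 * INR n + 1) * u) * sinh (t * u)) / ((2 * INR n + 1) ^ 2 + t ^ 2).

Lemma odd_sqr_pos (n : nat) (t : R) : 0 < (2 * INR n + 1) ^ 2 + t ^ 2.
Proof. have := pos_INR n; nra. Qed.

Lemma is_derive_prim (t : R) (n : nat) (u : R) :
  is_derive (prim t n) u (cosh (t * u) * cos ((2 * INR n + 1) * u)).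
Proof.
have h := odd_sqr_pos n t; rewrite /prim.
by auto_derive => //; field; lra.
Qed.

(** The integral over [0, u] of cosh(tv) - 1 against the Dirichlet kernel, written through
    antiderivatives so that the mean value theorem replaces integration. *)
Definition defect (t : R) (N : nat) (u : R) : R :=
  sum_n (fun n => prim t n u - prim 0 n u) N.

Lemma is_derive_defect (t : R) (N : nat) (u : R) :
  is_derive (defect t N) u ((cosh (t * u) - 1) * dirichlet N u).
Proof.
rewrite /dirichlet -[X in is_derive _ _ X](sum_n_mult_l (K := R_Ring)).
apply: is_derive_sum_n => n _.
have -> : mult (cosh (t * u) - 1) (cos ((2 * INR n + 1) * u)) =
  minus (cosh (t * u) * cos ((2 * INR n + 1) * u))
        (cosh (0 * u) * cos ((2 * INR n + 1) * u)).
  rewrite Rmult_0_l cosh_0 /minus /plus /opp /mult /=; ring.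
by apply: is_derive_minus; exact: is_derive_prim.
Qed.

Lemma defect_0 (t : R) (N : nat) : defect t N 0 = 0.
Proof.
have h0 s n : prim s n 0 = 0.
  by rewrite /prim !Rmult_0_r sin_0 sinh_0 /Rdiv; ring.
rewrite /defect (sum_n_ext _ (fun=> 0)) ?sum_n_const ?Rmult_0_r // => n.
by rewrite !h0 Rminus_0_r.
Qed.

(* 2 sin u times the Dirichlet kernel is bounded by 1, and cosh(tu) - 1 is O(u). *)
Lemma defect_small (t : R) (N : nat) (d : R) : 0 < d <= 1 ->
  Rabs (defect t N d) <= Rabs t * exp (Rabs t) * d.
Proof.
move=> hd.
have := MVT_bound (defect t N) _ 0 d (Rabs t * exp (Rabs t)) (proj1 hd)
  (fun c _ => is_derive_defect t N c).
rewrite defect_0 !Rminus_0_r; apply=> c hc.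
have hs : c / 2 <= sin c by apply: sin_ge_half; lra.
have h1 : Rabs (dirichlet N c) * c <= 1.
  have : Rabs (dirichlet N c * (2 * sin c)) <= 1.
    rewrite dirichlet_sin; apply: Rabs_le; exact: SIN_bound.
  rewrite Rabs_mult (Rabs_pos_eq (2 * sin c)); last lra.
  have := Rabs_pos (dirichlet N c); nra.
have h2 : Rabs (cosh (t * c) - 1) <= Rabs t * exp (Rabs t) * c.
  by apply: Rabs_cosh_sub1_le; lra.
rewrite Rabs_mult.
have h3 := Rmult_le_compat_r _ _ _ (Rabs_pos (dirichlet N c)) h2.
have h4 : 0 <= Rabs t * exp (Rabs t).
  by apply: Rmult_le_pos; [exact: Rabs_pos | have := exp_pos (Rabs t); lra].
nra.
Qed.

(* Away from 0 one integrates by parts against sin(2(N+1)u): adding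
   h(u) cos(2(N+1)u) / (2(N+1)), with h(u) = (cosh(tu) - 1) / (2 sin u), leaves a
   function whose derivative is O(1/N). *)
Lemma defect_large (t d : R) : 0 < d <= 1 ->
  exists K, forall N, Rabs (defect t N (PI / 2) - defect t N d) <= K / INR N.+1.
Proof.
move=> hd; have pi3 := PI2_3_2.
set E := exp (Rabs t * (PI / 2)).
have hE : 0 < E by exact: exp_pos.
have hsd : 0 < sin d by apply: sin_gt_0; lra.
(* [K] will bound [dh] and [K'] will bound [h] on [d, PI/2], where sin u >= sin d > 0 and [E]
   dominates cosh(tu) and |sinh(tu)|. *)
set K := (Rabs t * E + E + 1) / (2 * sin d ^ 2).
set K' := (E + 1) / (2 * sin d).
exists (K * (PI / 2) + 2 * K') => N.
have hM : 0 < INR N.+1 by apply: lt_0_INR; lia.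
pose h u := (cosh (t * u) - 1) / (2 * sin u).
pose dh u := (t * sinh (t * u) * sin u - (cosh (t * u) - 1) * cos u) / (2 * sin u ^ 2).
pose W u := defect t N u + h u * cos (2 * INR N.+1 * u) / (2 * INR N.+1).
have hs u : d <= u <= PI / 2 -> sin d <= sin u by move=> hu; apply: sin_incr_1; lra.
have hch u : d <= u <= PI / 2 -> Rabs (t * u) <= Rabs t * (PI / 2).
  move=> hu; rewrite Rabs_mult; apply: Rmult_le_compat_l; first exact: Rabs_pos.
  rewrite Rabs_pos_eq; lra.
have hc1 u : d <= u <= PI / 2 -> Rabs (cosh (t * u) - 1) <= E + 1.
  move=> hu; apply: Rle_trans (Rabs_triang _ _) _.
  rewrite Rabs_Ropp Rabs_R1; apply: Rplus_le_compat_r.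
  by apply: Rle_trans (Rabs_cosh_le _) (exp_le _ _ (hch u hu)).
have hh u : d <= u <= PI / 2 -> Rabs (h u) <= K'.
  move=> hu; rewrite /h /K' Rabs_div; last by have := hs u hu; lra.
  rewrite (Rabs_pos_eq (2 * sin u)); last by have := hs u hu; lra.
  apply: Rmult_le_compat; [exact: Rabs_pos| |exact: hc1|].
    by apply: Rlt_le; apply: Rinv_0_lt_compat; have := hs u hu; lra.
  by apply: Rinv_le_contravar; have := hs u hu; lra.
have hdh u : d <= u <= PI / 2 -> Rabs (dh u) <= K.
  move=> hu; have hsu := hs u hu.
  have hp : 2 * sin d ^ 2 <= 2 * sin u ^ 2 by nra.
  have hp' : 0 < 2 * sin d ^ 2 by nra.
  rewrite /dh /K Rabs_div; last lra.
  rewrite (Rabs_pos_eq (2 * sin u ^ 2)); last lra.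
  apply: Rmult_le_compat; [exact: Rabs_pos| | |exact: Rinv_le_contravar].
    by apply: Rlt_le; apply: Rinv_0_lt_compat; lra.
  apply: Rle_trans (Rabs_triang _ _) _; rewrite Rabs_Ropp (Rabs_mult (t * _)) (Rabs_mult t) (Rabs_mult (cosh _ - 1)).
  have a1 : Rabs (sin u) <= 1 by apply: Rabs_le; exact: SIN_bound.
  have a2 : Rabs (cos u) <= 1 by apply: Rabs_le; exact: COS_bound.
  have a3 : Rabs (sinh (t * u)) <= E.
    by apply: Rle_trans (Rabs_sinh_le _) (exp_le _ _ (hch u hu)).
  have a4 := hc1 u hu.
  have b1 := Rabs_pos (sin u); have b2 := Rabs_pos (cos u).
  have b3 := Rabs_pos (sinh (t * u)); have b4 := Rabs_pos (cosh (t * u) - 1).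
  have b5 := Rabs_pos t.
  rewrite Rplus_assoc -(Rmult_1_r (Rabs t * E)) -(Rmult_1_r (E + 1)).
  apply: Rplus_le_compat; last exact: Rmult_le_compat.
  apply: Rmult_le_compat => //; first exact: Rmult_le_pos.
  exact: Rmult_le_compat_l.
have hW c : d <= c <= PI / 2 ->
    is_derive W c (dh c * cos (2 * INR N.+1 * c) / (2 * INR N.+1)).
  move=> hc; have hsc := hs c hc.
  (* By [dirichlet_sin], differentiating the cosine in [W] produces exactly the term that cancels
     the derivative of [defect]; only the part with [dh] survives. *)
  have -> : dh c * cos (2 * INR N.+1 * c) / (2 * INR N.+1) =
     plus ((cosh (t * c) - 1) * dirichlet N c)
       (dh c * cos (2 * INR N.+1 * c) / (2 * INR N.+1) - h c * sin (2 * INR N.+1 * c)).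
    rewrite -dirichlet_sin /h; change plus with Rplus.
    by move: (INR N.+1) hM => m hM; field; lra.
  apply: is_derive_plus; first exact: is_derive_defect.
  rewrite /h /dh; move: (INR N.+1) hM => m hM.
  by auto_derive; [lra | field; lra].
have hcos x : Rabs (cos x) <= 1 by apply: Rabs_le; exact: COS_bound.
have hWb : Rabs (W (PI / 2) - W d) <= K / (2 * INR N.+1) * (PI / 2 - d).
  apply: MVT_bound hW _; first lra.
  move=> c hc; rewrite /Rdiv (Rabs_mult (_ * _)) (Rabs_mult (dh c)) (Rabs_pos_eq (/ (2 * _))); last first.
    by apply: Rlt_le; apply: Rinv_0_lt_compat; lra.
  apply: Rmult_le_compat_r.
    by apply: Rlt_le; apply: Rinv_0_lt_compat; lra.
  have := hdh c ltac:(lra); have := hcos (2 * INR N.+1 * c).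
  have := Rabs_pos (dh c); have := Rabs_pos (cos (2 * INR N.+1 * c)); nra.
have hb c : d <= c <= PI / 2 ->
    Rabs (h c * cos (2 * INR N.+1 * c) / (2 * INR N.+1)) <= K' / (2 * INR N.+1).
  move=> hc; rewrite /Rdiv (Rabs_mult (_ * _)) (Rabs_mult (h c)) (Rabs_pos_eq (/ (2 * _))); last first.
    by apply: Rlt_le; apply: Rinv_0_lt_compat; lra.
  apply: Rmult_le_compat_r.
    by apply: Rlt_le; apply: Rinv_0_lt_compat; lra.
  have := hh c hc; have := hcos (2 * INR N.+1 * c).
  have := Rabs_pos (h c); have := Rabs_pos (cos (2 * INR N.+1 * c)); nra.
have hb1 := hb d ltac:(lra); have hb2 := hb (PI / 2) ltac:(lra).
have -> : defect t N (PI / 2) - defect t N d = (W (PI / 2) - W d)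
    + (h d * cos (2 * INR N.+1 * d) / (2 * INR N.+1)
       - h (PI / 2) * cos (2 * INR N.+1 * (PI / 2)) / (2 * INR N.+1)).
  rewrite /W; ring.
apply: Rle_trans (Rabs_triang _ _) _.
have hb3 (x y : R) : Rabs (x - y) <= Rabs x + Rabs y.
  by rewrite -(Rabs_Ropp y); exact: Rabs_triang.
have hK : 0 <= K by apply: Rle_trans (Rabs_pos _) (hdh d _); lra.
have hK' : 0 <= K' by apply: Rle_trans (Rabs_pos _) (hh d _); lra.
apply: (Rle_trans _ (K / (2 * INR N.+1) * (PI / 2 - d)
   + (K' / (2 * INR N.+1) + K' / (2 * INR N.+1)))).
  apply: Rplus_le_compat => //; apply: Rle_trans (hb3 _ _) _.
  exact: Rplus_le_compat.
have -> : K / (2 * INR N.+1) * (PI / 2 - d) + (K' / (2 * INR N.+1) + K' / (2 * INR N.+1))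
  = (K * ((PI / 2 - d) / 2) + K') / INR N.+1 by field; lra.
apply: Rmult_le_compat_r; first by apply: Rlt_le; apply: Rinv_0_lt_compat.
nra.
Qed.

(** A Riemann-Lebesgue argument: [0, d] contributes O(d) uniformly in N, and for fixed d the rest is
    O(1/N). *)
Lemma defect_lim (t : R) : is_lim_seq (fun N => defect t N (PI / 2)) 0.
Proof.
apply/is_lim_seq_spec => eps; have he := cond_pos eps.
pose C := Rabs t * exp (Rabs t).
have hC : 0 <= C.
  by apply: Rmult_le_pos; [exact: Rabs_pos | have := exp_pos (Rabs t); lra].
(* [d] is fixed before N, because the constant of [defect_large] depends on it; [C + 1] avoids a
   zero denominator when t = 0. *)
pose d := Rmin 1 (eps / (2 * (C + 1))).
have hd0 : 0 < eps / (2 * (C + 1)) by apply: Rdiv_lt_0_compat; lra.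
have hd : 0 < d <= 1.
  by split; [apply: Rmin_glb_lt; lra | exact: Rmin_l].
have hCd : C * d < eps / 2.
  have hd' : (C + 1) * d <= eps / 2.
    have -> : eps / 2 = (C + 1) * (eps / (2 * (C + 1))) by field; lra.
    by apply: Rmult_le_compat_l; [lra | exact: Rmin_r].
  nra.
have [K hK] := defect_large t d hd.
have hl : is_lim_seq (fun N => K / INR N.+1) 0.
  have -> : Finite 0 = Rbar_mult K 0 by rewrite /= Rmult_0_r.
  apply: is_lim_seq_scal_l.
  have -> : Finite 0 = Rbar_inv p_infty by [].
  apply: is_lim_seq_inv => //.
  by apply/(is_lim_seq_incr_1 INR); exact: is_lim_seq_INR.
have he2 : 0 < eps / 2 by lra.
move/is_lim_seq_spec: hl => /(_ (mkposreal _ he2)) [N0 hN0].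
exists N0 => N /hN0 /=; rewrite !Rminus_0_r => h1.
have := Rle_abs (K / INR N.+1).
have := hK N; have := defect_small t N d hd; rewrite -/C.
have := Rabs_triang (defect t N (PI / 2) - defect t N d) (defect t N d).
have -> : defect t N (PI / 2) - defect t N d + defect t N d = defect t N (PI / 2) by ring.
rewrite /= in h1 *; lra.
Qed.

Lemma cos_sin_odd_PI2 (n : nat) :
  cos ((2 * INR n + 1) * (PI / 2)) = 0 /\ sin ((2 * INR n + 1) * (PI / 2)) = (-1) ^ n.
Proof.
elim: n => [|n [IHc IHs]].
  by rewrite /= Rmult_0_r Rplus_0_l Rmult_1_l cos_PI2 sin_PI2.
have -> : (2 * INR n.+1 + 1) * (PI / 2) = (2 * INR n + 1) * (PI / 2) + PI.
  by rewrite S_INR; field.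
by rewrite neg_cos neg_sin IHc IHs /=; split; ring.
Qed.

Lemma leibniz_series :
  is_lim_seq (fun N => sum_n (fun n => (-1) ^ n / (2 * INR n + 1)) N) (PI / 4).
Proof.
have := Alt_PI_eq; rewrite /Alt_PI; case: exist_PI => l hl hpi.
have -> : PI / 4 = l by lra.
apply: is_lim_seq_ext (proj2 (is_lim_seq_Reals _ _) hl) => N.
rewrite -sum_n_Reals; apply: sum_n_ext => n.
rewrite /tg_alt /PI_tg plus_INR mult_INR /=; congr (_ / _); ring.
Qed.

Lemma cosh_pos (y : R) : 0 < cosh y.
Proof. have := exp_pos y; have := exp_pos (- y); rewrite /cosh; lra. Qed.

(** At PI/2, [defect] plus the Leibniz partial sum is cosh(t PI/2) times the partial sum here; the
    former tends to 0 and the Leibniz sum to PI/4. *)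
Lemma sech_series (t : R) :
  is_lim_seq
    (fun N => sum_n (fun n => (-1) ^ n * (2 * INR n + 1) / ((2 * INR n + 1) ^ 2 + t ^ 2)) N)
    (PI / (4 * cosh (t * (PI / 2)))).
Proof.
have hc := cosh_pos (t * (PI / 2)).
have -> : Finite (PI / (4 * cosh (t * (PI / 2)))) =
   Rbar_mult (/ cosh (t * (PI / 2))) (0 + PI / 4).
  by rewrite /=; congr Finite; field; lra.
apply: is_lim_seq_ext; last first.
  apply: is_lim_seq_scal_l; apply: is_lim_seq_plus'; first exact: (defect_lim t).
  exact: leibniz_series.
move=> N /=; rewrite /defect -[X in _ * X](sum_n_plus (G := R_AbelianMonoid)) -[LHS](sum_n_mult_l (K := R_Ring)); apply: sum_n_ext => n.
rewrite /prim; have [-> ->] := cos_sin_odd_PI2 n.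
rewrite Rmult_0_l cosh_0 sinh_0 /plus /mult /=.
have h1 := odd_sqr_pos n t; have h2 := pos_INR n.
field; nra.
Qed.

(** * Complex limits and symmetric partial sums *)

Lemma filterlim_C_Cmod (u : nat -> C) (s : C) :
  filterlim u eventually (locally s) <->
  (forall eps : R, 0 < eps ->
     exists N, forall n : nat, (N <= n)%coq_nat -> Cmod (u n - s) < eps).
Proof.
have H := @filterlim_locally_ball_norm C_AbsRing nat C_NormedModule eventually _ u s.
split.
  by move/H => h eps he; exact: (h (mkposreal eps he)).
by move=> h; apply/H => eps; apply: h; exact: cond_pos.
Qed.

Definition sum_sym (F : Z -> C) (N : nat) : C :=
  sum_n (fun i : nat => F (Z.of_nat i - Z.of_nat N)%Z) (2 * N)%nat.

Lemma sum_sym0 (F : Z -> C) : sum_sym F 0 = F 0%Z.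
Proof. by rewrite /sum_sym muln0 sum_O. Qed.

Lemma plusCE (x y : C) : plus x y = (x + y)%C.
Proof. by []. Qed.

Lemma sum_symS (F : Z -> C) (N : nat) :
  sum_sym F N.+1 = (sum_sym F N + F (Z.of_nat N.+1) + F (- Z.of_nat N.+1)%Z)%C.
Proof.
rewrite /sum_sym.
have -> : (2 * N.+1 = (2 * N).+2)%nat by lia.
(* The last index stands for N+1 and the first for -(N+1); once both are peeled off, the others
   shift by one onto the window of radius N. *)
rewrite sum_Sn /sum_n sum_Sn_m; last lia.
rewrite -sum_n_m_S !plusCE.
have -> : (Z.of_nat (2 * N).+2 - Z.of_nat N.+1 = Z.of_nat N.+1)%Z by lia.
have -> : (Z.of_nat 0 - Z.of_nat N.+1 = - Z.of_nat N.+1)%Z by lia.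
rewrite (sum_n_m_ext _ (fun i => F (Z.of_nat i - Z.of_nat N)%Z)); last first.
  by move=> i; rewrite (_ : _ - _ = Z.of_nat i - Z.of_nat N)%Z; [|lia].
ring.
Qed.

Lemma sum_symZ (F : Z -> C) (c : C) (N : nat) :
  sum_sym (fun n => c * F n)%C N = (c * sum_sym F N)%C.
Proof. by elim: N => [|N IHN]; rewrite ?sum_sym0 // !sum_symS IHN; ring. Qed.

Lemma sum_symD (F G : Z -> C) (N : nat) :
  sum_sym (fun n => F n + G n)%C N = (sum_sym F N + sum_sym G N)%C.
Proof. by elim: N => [|N IHN]; rewrite ?sum_sym0 // !sum_symS IHN; ring. Qed.

Lemma eq_sum_sym (F G : Z -> C) (N : nat) : (forall n, F n = G n) ->
  sum_sym F N = sum_sym G N.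
Proof. by move=> h; elim: N => [|N IHN]; rewrite ?sum_sym0 // !sum_symS IHN !h. Qed.

Lemma IZR_odd_neq0 (n : Z) : IZR (2 * n + 1) <> 0.
Proof. by apply: not_0_IZR; lia. Qed.

Lemma Cmod_sum_sym_le (F : Z -> C) (K : R) (N : nat) :
  (forall n, Cmod (F n) <= K / IZR (2 * n + 1) ^ 2) ->
  Cmod (sum_sym F N) <= 5 * K.
Proof.
move=> hF.
have hK : 0 <= K.
  by have := hF 0%Z; have := Cmod_ge_0 (F 0%Z); rewrite /= Rmult_1_r Rmult_1_r; lra.
(* The sharper bound makes the induction telescope: the terms at N+1 and -(N+1) are each at most
   2K/((N+1)(N+2)), together the increment of -4K/(N+1). *)
have : Cmod (sum_sym F N) <= (5 - 4 / INR N.+1) * K.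
  elim: N => [|N IHN].
    by rewrite sum_sym0 /=; have := hF 0%Z; rewrite /= Rmult_1_r Rmult_1_r; lra.
  rewrite sum_symS.
  apply: Rle_trans (Cmod_triangle _ _) _.
  apply: Rle_trans (Rplus_le_compat_r _ _ _ (Cmod_triangle _ _)) _.
  have h1 := hF (Z.of_nat N.+1); have h2 := hF (- Z.of_nat N.+1)%Z.
  have hN := pos_INR N.
  have e1 : IZR (2 * Z.of_nat N.+1 + 1) = 2 * INR N + 3.
    by rewrite plus_IZR mult_IZR -INR_IZR_INZ S_INR; ring.
  have e2 : IZR (2 * - Z.of_nat N.+1 + 1) = - (2 * INR N + 1).
    by rewrite plus_IZR mult_IZR opp_IZR -INR_IZR_INZ S_INR; ring.
  rewrite e1 in h1; rewrite e2 in h2.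
  have b1 : / (2 * INR N + 3) ^ 2 <= 2 / ((INR N + 1) * (INR N + 2)).
    rewrite -[2 / _]Rinv_div; apply: Rinv_le_contravar; nra.
  have b2 : / (- (2 * INR N + 1)) ^ 2 <= 2 / ((INR N + 1) * (INR N + 2)).
    rewrite -[2 / _]Rinv_div; apply: Rinv_le_contravar; nra.
  have c1 := Rmult_le_compat_l _ _ _ hK b1; have c2 := Rmult_le_compat_l _ _ _ hK b2.
  have -> : (5 - 4 / INR N.+2) * K = (5 - 4 / INR N.+1) * K +
     (K * (2 / ((INR N + 1) * (INR N + 2))) + K * (2 / ((INR N + 1) * (INR N + 2)))).
    by rewrite !S_INR; field; lra.
  rewrite /Rdiv in h1 h2 IHN *; lra.
have : 0 < INR N.+1 by apply: lt_0_INR; lia.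
move/Rinv_0_lt_compat => h1 h2; rewrite /Rdiv in h2; nra.
Qed.

(** * Taylor remainders and termwise differentiation in x *)

(** With u = 1/(z+h) and w = 1/z the hypothesis is the resolvent identity, and the bound is the
    first-order Taylor estimate of z^(-p), obtained by pure algebra. *)
Lemma inv_pow_taylor (u w h : C) (B : R) (p : nat) :
  (u - w = - (h * u * w))%C -> Cmod u <= B -> Cmod w <= B ->
  Cmod (u ^ p - w ^ p + RtoC (INR p) * h * w ^ p.+1)%C <= INR p ^ 2 * Cmod h ^ 2 * B ^ (p.+2).
Proof.
move=> huw hu hw.
have hB : 0 <= B by apply: Rle_trans (Cmod_ge_0 u) hu.
elim: p => [|p IHp].
  have -> : (u ^ 0 - w ^ 0 + RtoC (INR 0) * h * w ^ 1)%C = RtoC 0 by rewrite /=; ring.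
  rewrite Cmod_0 [INR 0]/=; lra.
(* The remainders satisfy R_(p+1) = u R_p + (p+1) h^2 u w^(p+2), and p^2 + (p+1) <= (p+1)^2 closes
   the induction. *)
have -> : (u ^ p.+1 - w ^ p.+1 + RtoC (INR p.+1) * h * w ^ p.+2)%C =
  (u * (u ^ p - w ^ p + RtoC (INR p) * h * w ^ p.+1)
   + RtoC (INR p + 1) * h ^ 2 * (u * w ^ p.+2))%C.
  have hD : (u - w + h * u * w = RtoC 0)%C by rewrite huw; ring.
  transitivity (u * (u ^ p - w ^ p + RtoC (INR p) * h * w ^ p.+1)
     + RtoC (INR p + 1) * h ^ 2 * (u * w ^ p.+2)
     + w ^ p * (u - w + h * u * w) * (1 - RtoC (INR p + 1) * h * w))%C.
    rewrite S_INR RtoC_plus !Cpow_S /=; ring.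
  by rewrite hD; ring.
apply: Rle_trans (Cmod_triangle _ _) _.
have -> : Cmod (RtoC (INR p + 1) * h ^ 2 * (u * w ^ p.+2))%C =
    (INR p + 1) * Cmod h ^ 2 * (Cmod u * Cmod w ^ p.+2).
  rewrite (Cmod_mult (_ * _)) (Cmod_mult (RtoC _)) (Cmod_mult u) !Cmod_pow Cmod_R.
  by rewrite Rabs_pos_eq //; have := pos_INR p; lra.
rewrite (Cmod_mult u).
have hwp : Cmod w ^ p.+2 <= B ^ p.+2 by apply: pow_incr; split => //; exact: Cmod_ge_0.
have hp := pos_INR p.
have t1 : Cmod u * Cmod (u ^ p - w ^ p + RtoC (INR p) * h * w ^ p.+1)%C <=
    B * (INR p ^ 2 * Cmod h ^ 2 * B ^ (p.+2)).
  by apply: Rmult_le_compat => //; exact: Cmod_ge_0.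
have t2 : Cmod u * Cmod w ^ p.+2 <= B * B ^ p.+2.
  by apply: Rmult_le_compat => //; [exact: Cmod_ge_0 | apply: pow_le; exact: Cmod_ge_0].
have t3 : (INR p + 1) * Cmod h ^ 2 * (Cmod u * Cmod w ^ p.+2) <=
   (INR p + 1) * Cmod h ^ 2 * (B * B ^ p.+2).
  apply: Rmult_le_compat_l => //; apply: Rmult_le_pos; [lra|].
  by apply: pow_le; exact: Cmod_ge_0.
apply: Rle_trans (Rplus_le_compat _ _ _ _ t1 t3) _.
have -> : B ^ p.+3 = B * B ^ p.+2 by [].
rewrite S_INR.
have t4 : 0 <= Cmod h ^ 2 * (B * B ^ p.+2).
  apply: Rmult_le_pos; first by apply: pow_le; exact: Cmod_ge_0.
  by apply: Rmult_le_pos => //; exact: pow_le.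
have := Rmult_le_pos _ _ hp t4; nra.
Qed.

Definition pole (a x : R) (n : Z) : C := (RtoC x + RtoC (a * IZR (2 * n + 1)) * Ci)%C.

Lemma pole_im (a x : R) (n : Z) : Im (pole a x n) = a * IZR (2 * n + 1).
Proof. by rewrite /pole /=; ring. Qed.

Lemma pole_neq0 (a x : R) (n : Z) : a <> 0 -> pole a x n <> 0.
Proof.
move=> ha h; have := pole_im a x n; rewrite h /= => h'.
have := Rmult_integral_contrapositive _ _ (conj ha (IZR_odd_neq0 n)); exact.
Qed.

(** The modulus is at least the imaginary part, which does not involve [x]; hence a bound uniform in
    [x]. *)
Lemma Cmod_inv_pole_le (a x : R) (n : Z) : a <> 0 ->
  Cmod (/ pole a x n) <= / Rabs (a * IZR (2 * n + 1)).
Proof.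
move=> ha; rewrite Cmod_inv; last exact: pole_neq0.
apply: Rinv_le_contravar.
  by apply: Rabs_pos_lt; apply: Rmult_integral_contrapositive; split=> //; exact: IZR_odd_neq0.
by rewrite -(pole_im a x n); apply: Rle_trans (Rmax_r _ _) (Rmax_Cmod _).
Qed.

Definition eis (a : R) (p : nat) (x : R) (n : Z) : C :=
  (RtoC (powerRZ (-1) n) / pole a x n ^ p)%C.

Lemma Cmod_sign (n : Z) : Cmod (RtoC (powerRZ (-1) n)) = 1.
Proof.
rewrite Cmod_R; case: n => [|q|q] /=; rewrite ?Rabs_inv ?pow_1_abs ?Rabs_R1 //.
exact: Rinv_1.
Qed.

Lemma Rabs_odd_ge1 (n : Z) : 1 <= Rabs (IZR (2 * n + 1)).
Proof. by rewrite -abs_IZR; apply: (IZR_le 1); lia. Qed.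

(** Each remainder is O(h^2 / |2n+1|^(p+2)), hence O(h^2 / (2n+1)^2), so the bound is uniform in N
    even for p = 1, where the series itself does not converge absolutely. *)
Lemma eis_taylor (a : R) (p : nat) (x h : R) (N : nat) : a <> 0 ->
  Cmod (sum_sym (eis a p (x + h)) N - sum_sym (eis a p x) N
        - RtoC h * (RtoC (- INR p) * sum_sym (eis a p.+1 x) N))%C
  <= 5 * (INR p ^ 2 / Rabs a ^ p.+2) * h ^ 2.
Proof.
move=> ha.
have hA : 0 < Rabs a by exact: Rabs_pos_lt.
rewrite (_ : _ - _ - _ = sum_sym (fun n => eis a p (x + h) n + ((RtoC (-1) * eis a p x n)
    + ((RtoC h * RtoC (INR p)) * eis a p.+1 x n)))  N)%C; last first.
  rewrite !(sum_symD, sum_symZ) RtoC_opp; ring.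
rewrite Rmult_assoc; apply: Cmod_sum_sym_le => n.
set z := pole a x n; set z' := pole a (x + h) n.
have hz : z <> 0 by exact: pole_neq0.
have hz' : z' <> 0 by exact: pole_neq0.
have -> : (eis a p (x + h) n + (RtoC (-1) * eis a p x n + RtoC h * RtoC (INR p) * eis a p.+1 x n) =
   RtoC (powerRZ (-1) n) * ((/ z') ^ p - (/ z) ^ p + RtoC (INR p) * RtoC h * (/ z) ^ p.+1))%C.
  rewrite /eis -/z -/z' !Cpow_inv // /Cdiv; ring.
rewrite Cmod_mult Cmod_sign Rmult_1_l.
apply: Rle_trans (inv_pow_taylor _ _ _ (/ Rabs (a * IZR (2 * n + 1))) _ _ _ _) _.
- have e : z' = (z + RtoC h)%C by rewrite /z /z' /pole RtoC_plus; ring.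
  by rewrite e in hz' *; field.
- exact: Cmod_inv_pole_le.
- exact: Cmod_inv_pole_le.
have ho := Rabs_odd_ge1 n.
rewrite Cmod_R Rabs_mult -(pow2_abs h) -(pow2_abs (IZR _)).
have -> : INR p ^ 2 / Rabs a ^ p.+2 * Rabs h ^ 2 / Rabs (IZR (2 * n + 1)) ^ 2 =
  INR p ^ 2 * Rabs h ^ 2 * (/ Rabs a ^ p.+2 * / Rabs (IZR (2 * n + 1)) ^ 2).
  have : Rabs a ^ p.+2 <> 0 by apply: pow_nonzero; lra.
  by move=> ?; field; split => //; lra.
apply: Rmult_le_compat_l.
  by apply: Rmult_le_pos; exact: pow2_ge_0.
rewrite Rinv_mult Rpow_mult_distr !pow_inv.
apply: Rmult_le_compat_l.
  by apply: Rlt_le; apply: Rinv_0_lt_compat; exact: pow_lt.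
apply: Rinv_le_contravar; first by apply: pow_lt; lra.
apply: Rle_pow => //; lia.
Qed.

(* Pointwise convergence passes to derivatives when the Taylor remainders are bounded
   uniformly in [N]: fix a small increment [h] first, then let [N] tend to infinity. *)
Lemma derive_limit (F : nat -> R -> C) (F' : nat -> C) (g : R -> R) (x d M : R) :
  (forall y, filterlim (F^~ y) eventually (locally (RtoC (g y) * Ci)%C)) ->
  (forall N (h : R), Cmod (F N (x + h)%R - F N x - RtoC h * F' N)%C <= M * h ^ 2) ->
  is_derive g x d ->
  filterlim F' eventually (locally (RtoC d * Ci)%C).
Proof.
move=> hF hM /is_derive_Reals hd; apply/filterlim_C_Cmod => eps he.
have he4 : 0 < eps / 4 by lra.
have [dl hdl] := hd _ he4.
have hdl0 := cond_pos dl.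
have hM0 : 0 <= M.
  by have := Rle_trans _ _ _ (Cmod_ge_0 _) (hM 0%nat 1); rewrite /= !Rmult_1_r.
(* The first bound brings the difference quotient of [g] within eps/4 of [d], the second keeps the
   Taylor remainder M h^2 below h eps/4. *)
pose h := Rmin (dl / 2) (eps / (4 * (M + 1))).
have hh0 : 0 < h.
  by apply: Rmin_glb_lt; [lra | apply: Rdiv_lt_0_compat; lra].
have hh1 : Rabs h < dl.
  by rewrite Rabs_pos_eq; have := Rmin_l (dl / 2) (eps / (4 * (M + 1))); rewrite -/h; lra.
have hh2 : M * h < eps / 4.
  have hd' : (M + 1) * h <= eps / 4.
    have -> : eps / 4 = (M + 1) * (eps / (4 * (M + 1))) by field; lra.
    by apply: Rmult_le_compat_l; [lra | exact: Rmin_r].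
  nra.
have hge : 0 < h * (eps / 4) by nra.
have [N1 hN1] := proj1 (filterlim_C_Cmod _ _) (hF (x + h)) _ hge.
have [N2 hN2] := proj1 (filterlim_C_Cmod _ _) (hF x) _ hge.
exists (N1 + N2)%nat => N hN.
have {}hN1 := hN1 N ltac:(lia); have {}hN2 := hN2 N ltac:(lia).
have {}hM := hM N h.
have h3 : Rabs (g (x + h) - g x - d * h) < h * (eps / 4).
  have -> : g (x + h) - g x - d * h = h * ((g (x + h) - g x) / h - d) by field; lra.
  rewrite Rabs_mult (Rabs_pos_eq h); last lra.
  by apply: Rmult_lt_compat_l => //; apply: hdl => //; lra.
apply: (Rmult_lt_reg_l h) => //.
have -> : h * Cmod (F' N - RtoC d * Ci) = Cmod (RtoC h * (F' N - RtoC d * Ci)).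
  by rewrite Cmod_mult Cmod_R Rabs_pos_eq //; lra.
(* Four errors, each below h eps/4: the Taylor remainder, the convergence at x + h and at x, and the
   difference quotient of [g]. *)
have -> : (RtoC h * (F' N - RtoC d * Ci))%C =
  (- (F N (x + h)%R - F N x - RtoC h * F' N)
   + ((F N (x + h)%R - RtoC (g (x + h)%R) * Ci)
     + (- (F N x - RtoC (g x) * Ci)
     + RtoC (g (x + h) - g x - d * h)%R * Ci)))%C.
  rewrite !RtoC_minus RtoC_mult; ring.
apply: Rle_lt_trans (Cmod_triangle _ _) _.
have i1 := Cmod_triangle (F N (x + h)%R - RtoC (g (x + h)%R) * Ci)
   (- (F N x - RtoC (g x) * Ci) + RtoC (g (x + h) - g x - d * h)%R * Ci).
have i2 := Cmod_triangle (- (F N x - RtoC (g x) * Ci)) (RtoC (g (x + h) - g x - d * h)%R * Ci).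
rewrite Cmod_mult Cmod_R Cmod_Ci Rmult_1_r !Cmod_opp in i1 i2 *.
have : M * h ^ 2 < h * (eps / 4) by nra.
lra.
Qed.

(** Differentiating z^(-(p+1)) gives -(p+1) z^(-(p+2)), and the nonzero factor -(p+1) is then
    divided out. *)
Lemma eis_step (a : R) (p : nat) (g : R -> R) (x d : R) : a <> 0 ->
  (forall y, is_sum_sym (eis a p.+1 y) (RtoC (g y) * Ci)%C) ->
  is_derive g x (- INR p.+1 * d) ->
  is_sum_sym (eis a p.+2 x) (RtoC d * Ci)%C.
Proof.
move=> ha hg hd.
have hp : INR p.+1 <> 0 by apply: not_0_INR; lia.
have := derive_limit (fun N y => sum_sym (eis a p.+1 y) N)
  (fun N => RtoC (- INR p.+1) * sum_sym (eis a p.+2 x) N)%C g x _ _ hg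
  (fun N h => eis_taylor a p.+1 x h N ha) hd.
move/filterlim_C_Cmod => H; apply/filterlim_C_Cmod => eps he.
have hp0 : 0 < INR p.+1 by apply: lt_0_INR; lia.
have [|N hN] := H (INR p.+1 * eps); first by nra.
exists N => n /hN; rewrite -/(sum_sym _ n).
have -> : (RtoC (- INR p.+1) * sum_sym (eis a p.+2 x) n - RtoC (- INR p.+1 * d) * Ci =
   RtoC (- INR p.+1) * (sum_sym (eis a p.+2 x) n - RtoC d * Ci))%C.
  by rewrite RtoC_mult; ring.
rewrite Cmod_mult Cmod_R Rabs_Ropp Rabs_pos_eq; last lra.
by move/Rmult_lt_reg_l; apply.
Qed.

(** * The base case of exponent one *)

Lemma sign_of_nat (n : nat) : powerRZ (-1) (Z.of_nat n) = (-1) ^ n.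
Proof. by rewrite pow_powerRZ. Qed.

Lemma sign_opp_of_nat (n : nat) : powerRZ (-1) (- Z.of_nat n.+1) = - (-1) ^ n.
Proof.
rewrite /= SuccNat2Pos.id_succ /=.
have h : (-1) ^ n * (-1) ^ n = 1 by rewrite -Rpow_mult_distr Rmult_opp_opp !Rmult_1_l pow1.
have h' : (-1) ^ n <> 0 by move=> h0; rewrite h0 in h; lra.
apply: (Rmult_eq_reg_l ((-1) ^ n)) => //.
have -> : (-1) ^ n * - (-1) ^ n = -1 by lra.
by field.
Qed.

Lemma eis_base (a x : R) : a <> 0 ->
  is_sum_sym (eis a 1 x) (RtoC (- (PI / (2 * a)) / cosh (x * PI / (2 * a))) * Ci)%C.
Proof.
move=> ha.
(* [Q] runs over the pairs (n, -n-1): their two terms combine to -2i/a times a summand of the sech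
   expansion at t = x/a. *)
pose Q N := sum_n (fun n => -2 / a *
   ((-1) ^ n * (2 * INR n + 1) / ((2 * INR n + 1) ^ 2 + (x / a) ^ 2))) N.
have hQ : is_lim_seq Q (- (PI / (2 * a)) / cosh (x * PI / (2 * a))).
  have -> : Finite (- (PI / (2 * a)) / cosh (x * PI / (2 * a))) =
     Rbar_mult (-2 / a) (PI / (4 * cosh (x / a * (PI / 2)))).
    rewrite /=; congr Finite.
    have -> : x * PI / (2 * a) = x / a * (PI / 2) by field.
    have := cosh_pos (x / a * (PI / 2)) => hc; field; lra.
  apply: is_lim_seq_ext; last by apply: is_lim_seq_scal_l; exact: sech_series.
  by move=> N /=; rewrite -[LHS](sum_n_mult_l (K := R_Ring)).
have hpair n : (eis a 1 x (Z.of_nat n) + eis a 1 x (- Z.of_nat n.+1) =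
  RtoC (-2 / a * ((-1) ^ n * (2 * INR n + 1) / ((2 * INR n + 1) ^ 2 + (x / a) ^ 2))) * Ci)%C.
  have hn := pos_INR n.
  have e1 : IZR (2 * Z.of_nat n + 1) = 2 * INR n + 1.
    by rewrite plus_IZR mult_IZR -INR_IZR_INZ.
  have e2 : IZR (2 * - Z.of_nat n.+1 + 1) = - (2 * INR n + 1).
    by rewrite plus_IZR mult_IZR opp_IZR -INR_IZR_INZ S_INR; ring.
  rewrite /eis /pole !Cpow_1_r sign_of_nat sign_opp_of_nat e1 e2.
  have hm : 0 < 2 * INR n + 1 by lra.
  move: (2 * INR n + 1) ((-1) ^ n) hm => m s hm.
  have ham : 0 < (a * m) ^ 2 by apply: pow2_gt_0; nra.
  rewrite /Cdiv /Cinv /Cmult /Cplus /RtoC /Ci; apply: injective_projections => /=.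
    by field; nra.
  by field; nra.
(* The window from -N to N lacks the partner -(N+1) of N, so one unpaired term remains; it is
   O(1/N). *)
have hsum N : sum_sym (eis a 1 x) N = (RtoC (Q N) * Ci - eis a 1 x (- Z.of_nat N.+1))%C.
  rewrite /Q; elim: N => [|N IHN].
    by rewrite sum_sym0 sum_O -(hpair 0%nat) [Z.of_nat 0]/=; ring.
  rewrite sum_symS IHN sum_Sn; change plus with Rplus.
  rewrite RtoC_plus Cmult_plus_distr_r -hpair; ring.
apply/filterlim_C_Cmod => eps he.
have hl : is_lim_seq (fun N => / Rabs a * / INR N.+1) 0.
  have -> : Finite 0 = Rbar_mult (/ Rabs a) 0 by rewrite /= Rmult_0_r.
  apply: is_lim_seq_scal_l.
  have -> : Finite 0 = Rbar_inv p_infty by [].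
  apply: is_lim_seq_inv => //.
  by apply/(is_lim_seq_incr_1 INR); exact: is_lim_seq_INR.
have he2 : 0 < eps / 2 by lra.
move/is_lim_seq_spec: hl => /(_ (mkposreal _ he2)) [N1 hN1].
move/is_lim_seq_spec: hQ => /(_ (mkposreal _ he2)) [N2 hN2].
exists (N1 + N2)%nat => N hN; rewrite -/(sum_sym _ N) hsum.
have {}hN1 : Rabs (/ Rabs a * / INR N.+1 - 0) < eps / 2 by apply: hN1; lia.
have {}hN2 : Rabs (Q N - - (PI / (2 * a)) / cosh (x * PI / (2 * a))) < eps / 2.
  by apply: hN2; lia.
rewrite Rminus_0_r in hN1.
have hA : 0 < Rabs a by exact: Rabs_pos_lt.
have h1 : Cmod (eis a 1 x (- Z.of_nat N.+1)) <= / Rabs a * / INR N.+1.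
  rewrite /eis /Cdiv Cmod_mult Cmod_sign Rmult_1_l Cpow_1_r.
  apply: Rle_trans (Cmod_inv_pole_le _ _ _ ha) _; rewrite Rabs_mult Rinv_mult.
  apply: Rmult_le_compat_l; first by apply: Rlt_le; exact: Rinv_0_lt_compat.
  rewrite plus_IZR mult_IZR opp_IZR -INR_IZR_INZ S_INR; have hN0 := pos_INR N.
  apply: Rinv_le_contravar; first lra.
  rewrite -Rabs_Ropp Rabs_pos_eq; lra.
move: (eis _ _ _ _) h1 => e h1.
have -> : (RtoC (Q N) * Ci - e - RtoC (- (PI / (2 * a)) / cosh (x * PI / (2 * a))) * Ci =
  RtoC (Q N - - (PI / (2 * a)) / cosh (x * PI / (2 * a))) * Ci + - e)%C.
  by rewrite RtoC_minus; ring.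
apply: Rle_lt_trans (Cmod_triangle _ _) _.
rewrite Cmod_opp Cmod_mult Cmod_Ci Cmod_R Rmult_1_r.
have := Rle_abs (/ Rabs a * / INR N.+1); lra.
Qed.

(** * Derivatives of sech and closed forms of the inner sums *)

Lemma cosh_sqr (y : R) : cosh y * cosh y = 1 + sinh y * sinh y.
Proof.
have h : exp y * exp (- y) = 1 by rewrite -exp_plus Rplus_opp_r exp_0.
rewrite /cosh /sinh; lra.
Qed.

Lemma is_derive_inv_cosh_pow (a x : R) (q : nat) :
  is_derive (fun x => / cosh (x * PI / (2 * a)) ^ q.+1) x
    (- INR q.+1 * (PI / (2 * a))
     * (sinh (x * PI / (2 * a)) / cosh (x * PI / (2 * a)) ^ q.+2)).
Proof.
have hc := cosh_pos (x * PI / (2 * a)).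
have hq : cosh (x * PI / (2 * a)) ^ q <> 0 by apply: pow_nonzero; lra.
have hS : cosh (x * PI / (2 * a)) ^ q.+1 <> 0 by apply: pow_nonzero; lra.
auto_derive; first exact: hS.
move: hq hc; rewrite -/(INR q.+1) /Rdiv -!tech_pow_Rmult.
set y := x * PI * / (2 * a).
move: (sinh y) (cosh y) (/ (2 * a)) (INR q.+1) => s c w m.
move: (c ^ q) => cq hq hc; field; split; lra.
Qed.

(** The product rule leaves a sinh^2, traded for cosh^2 - 1, so that only powers of sech remain. *)
Lemma is_derive_sinh_cosh_pow (a x : R) (q : nat) :
  is_derive (fun x => sinh (x * PI / (2 * a)) / cosh (x * PI / (2 * a)) ^ q.+1) x
    (PI / (2 * a) * (- INR q * / cosh (x * PI / (2 * a)) ^ q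
       + INR q.+1 * / cosh (x * PI / (2 * a)) ^ q.+2)).
Proof.
have hc := cosh_pos (x * PI / (2 * a)).
have hcs := cosh_sqr (x * PI / (2 * a)).
have hq : cosh (x * PI / (2 * a)) ^ q <> 0 by apply: pow_nonzero; lra.
have hS : cosh (x * PI / (2 * a)) ^ q.+1 <> 0 by apply: pow_nonzero; lra.
have -> : PI / (2 * a) * (- INR q * / cosh (x * PI / (2 * a)) ^ q
       + INR q.+1 * / cosh (x * PI / (2 * a)) ^ q.+2) =
  plus (mult (PI / (2 * a) * cosh (x * PI / (2 * a))) (/ cosh (x * PI / (2 * a)) ^ q.+1))
    (mult (sinh (x * PI / (2 * a))) (- INR q.+1 * (PI / (2 * a))
     * (sinh (x * PI / (2 * a)) / cosh (x * PI / (2 * a)) ^ q.+2))).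
  rewrite /plus /mult /= -/(INR q.+1) S_INR.
  set y := x * PI / (2 * a) in hc hcs hq *.
  move: (cosh y) (sinh y) (PI / (2 * a)) (INR q) hc hcs hq {hS} => c s w m hc hcs.
  move: (c ^ q) => cq hq.
  have -> : w * (- m * / cq + (m + 1) * / (c * (c * cq))) = w / cq / c / c * (- m * (c * c) + (m + 1)).
    by field; lra.
  rewrite hcs.
  have -> : w * c * / (c * cq) = w / cq / c / c * (c * c) by field; lra.
  rewrite hcs; field; lra.
apply: (is_derive_mult (fun x => sinh (x * PI / (2 * a)))); last 2 first.
- exact: is_derive_inv_cosh_pow.
- by move=> n m; rewrite /mult /= Rmult_comm.
auto_derive => //; rewrite /Rdiv; ring.
Qed.

(** The coefficient of sech^(2l+1) in the derivative of order 2j of sech. *)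
Definition sech_coef (j l : nat) : R := (-1) ^ l * INR (2 * l)`! * INR (Scoef j l).

Lemma INR_factS (n : nat) : INR (n.+1)`! = INR n.+1 * INR n`!.
Proof. by rewrite factS -multE mult_INR. Qed.

Lemma INR_fact_pos (n : nat) : 0 < INR n`!.
Proof. by apply: lt_0_INR; have := fact_gt0 n; lia. Qed.

Lemma INR_double (l : nat) : INR (2 * l)%nat = 2 * INR l.
Proof. by rewrite -multE mult_INR. Qed.

Lemma INR_fact_double (l : nat) :
  INR (2 * l.+1)`! = (2 * INR l + 1) * (2 * INR l + 2) * INR (2 * l)`!.
Proof.
rewrite (_ : 2 * l.+1 = (2 * l).+2)%nat; last lia.
rewrite !INR_factS !S_INR INR_double; ring.
Qed.

Lemma sech_coef0 (j : nat) : sech_coef j.+1 0 = sech_coef j 0.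
Proof. by rewrite /sech_coef ScoefTheory.Scoef_0. Qed.

(** The factor (2l+1)(2l+2) is the ratio of (2l+2)! to (2l)!. It is the p(p+1) of (sech^p)'' at p =
    2l+1, just as (2l+3)^2 is the p^2 at p = 2l+3. *)
Lemma sech_coefS (j l : nat) : (l < j)%nat ->
  sech_coef j.+1 l.+1 = (2 * INR l + 3) ^ 2 * sech_coef j l.+1
    - (2 * INR l + 1) * (2 * INR l + 2) * sech_coef j l.
Proof.
move=> hl; rewrite /sech_coef ScoefTheory.ScoefS //.
have -> : (expn (2 * l.+1 + 1) 2 = (2 * l.+1 + 1) * (2 * l.+1 + 1))%nat by rewrite mulnn.
have -> u v w : INR ((u + 1) * (u + 1) * v + w)%nat = (INR u + 1) ^ 2 * INR v + INR w.
  by rewrite -!plusE -!multE !(plus_INR, mult_INR) [INR 1]/=; ring.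
rewrite !INR_double !INR_fact_double !S_INR [(-1) ^ l.+1]/=; ring.
Qed.

Lemma sech_coef_last (j : nat) :
  sech_coef j.+1 j.+1 = - ((2 * INR j + 1) * (2 * INR j + 2) * sech_coef j j).
Proof.
by rewrite /sech_coef !ScoefTheory.Scoef_diag INR_fact_double /=; ring.
Qed.

(** For [e l] = sech^(2l+1) both sides are minus the derivative of order 2j+2 of sech; collecting
    the factors of each [e l] gives the recursion of [sech_coef]. *)
Lemma sech_coef_sum (j : nat) (e : nat -> R) :
  sum_n (fun l => sech_coef j l * (2 * INR l + 1)
      * (- (2 * INR l + 1) * e l + (2 * INR l + 2) * e l.+1)) j
  = - sum_n (fun l => sech_coef j.+1 l * e l) j.+1 :> R.
Proof.
(* Partial sums leave a boundary term in [e n.+1]; at n = j it is absorbed by [sech_coef_last]. *)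
have H n : (n <= j)%nat ->
  sum_n (fun l => sech_coef j l * (2 * INR l + 1)
      * (- (2 * INR l + 1) * e l + (2 * INR l + 2) * e l.+1)) n
  = - sum_n (fun l => sech_coef j.+1 l * e l) n
    + (2 * INR n + 1) * (2 * INR n + 2) * sech_coef j n * e n.+1 :> R.
  elim: n => [|n IHn] hn; first by rewrite !sum_O sech_coef0 /=; ring.
  rewrite !sum_Sn IHn; last exact: ltnW.
  change plus with Rplus; rewrite sech_coefS // S_INR; ring.
rewrite H // sum_Sn sech_coef_last; change plus with Rplus; ring.
Qed.

(** The derivative of order 2j of -(PI/(2a)) sech(PI x/(2a)), divided by (2j)!; [eis_even] is minus
    the next derivative, divided by (2j+1)!. The inner sums are purely imaginary, so real functions
    record them. *)
Definition eis_odd (a : R) (j : nat) (x : R) : R :=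
  - (PI / (2 * a)) ^ (2 * j).+1 / INR (2 * j)`!
  * sum_n (fun l => sech_coef j l * / cosh (x * PI / (2 * a)) ^ (2 * l).+1) j.

Definition eis_even (a : R) (j : nat) (x : R) : R :=
  - (PI / (2 * a)) ^ (2 * j).+2 / INR ((2 * j).+1)`!
  * sum_n (fun l => sech_coef j l * (2 * INR l + 1) *
      (sinh (x * PI / (2 * a)) / cosh (x * PI / (2 * a)) ^ (2 * l).+2)) j.

Lemma is_derive_eis_odd (a : R) (j : nat) (x : R) :
  is_derive (eis_odd a j) x (- INR (2 * j).+1 * eis_even a j x).
Proof.
have hf := INR_fact_pos (2 * j); have h1 : 0 < INR (2 * j).+1 by apply: lt_0_INR; lia.
rewrite /eis_odd /eis_even.
pose d l := sech_coef j l * (- INR (2 * l).+1 * (PI / (2 * a))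
     * (sinh (x * PI / (2 * a)) / cosh (x * PI / (2 * a)) ^ (2 * l).+2)).
rewrite (_ : - INR _ * _ = - (PI / (2 * a)) ^ (2 * j).+1 / INR (2 * j)`! * sum_n d j).
  apply: is_derive_scal; apply: is_derive_sum_n => l _.
  by apply: is_derive_scal; exact: is_derive_inv_cosh_pow.
rewrite (sum_n_ext d (fun l => mult (- (PI / (2 * a))) (sech_coef j l * (2 * INR l + 1) *
      (sinh (x * PI / (2 * a)) / cosh (x * PI / (2 * a)) ^ (2 * l).+2)))); last first.
  by move=> l; rewrite /d S_INR INR_double /mult /=; ring.
rewrite sum_n_mult_l INR_factS; change mult with Rmult.
rewrite -(tech_pow_Rmult _ (2 * j).+1).
move: (sum_n _ _) ((PI / (2 * a)) ^ (2 * j).+1) (PI / (2 * a)) => S P w.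
by field; lra.
Qed.

Lemma is_derive_eis_even (a : R) (j : nat) (x : R) :
  is_derive (eis_even a j) x (- INR (2 * j).+2 * eis_odd a j.+1 x).
Proof.
rewrite /eis_odd /eis_even.
have -> : (2 * j.+1 = (2 * j).+2)%nat by lia.
have hf := INR_fact_pos (2 * j).+1; have h1 : 0 < INR (2 * j).+2 by apply: lt_0_INR; lia.
pose d l := sech_coef j l * (2 * INR l + 1) *
  (PI / (2 * a) * (- INR (2 * l).+1 * / cosh (x * PI / (2 * a)) ^ (2 * l).+1
       + INR (2 * l).+2 * / cosh (x * PI / (2 * a)) ^ (2 * l).+3)).
rewrite (_ : - INR _ * _ = - (PI / (2 * a)) ^ (2 * j).+2 / INR ((2 * j).+1)`! * sum_n d j).
  apply: is_derive_scal; apply: is_derive_sum_n => l _.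
  by apply: is_derive_scal; exact: is_derive_sinh_cosh_pow.
rewrite (sum_n_ext d (fun l => mult (PI / (2 * a)) (sech_coef j l * (2 * INR l + 1)
   * (- (2 * INR l + 1) * / cosh (x * PI / (2 * a)) ^ (2 * l).+1
      + (2 * INR l + 2) * / cosh (x * PI / (2 * a)) ^ (2 * l.+1).+1)))); last first.
  move=> l; rewrite /d (_ : 2 * l.+1 = (2 * l).+2)%nat; last lia.
  rewrite !S_INR INR_double; change mult with Rmult.
  by refine (_ : @eq R _ _); ring.
rewrite sum_n_mult_l (sech_coef_sum j (fun l => / cosh (x * PI / (2 * a)) ^ (2 * l).+1)).
change mult with Rmult.
rewrite INR_factS -(tech_pow_Rmult _ (2 * j).+2).
move: (sum_n _ _) ((PI / (2 * a)) ^ (2 * j).+2) (PI / (2 * a)) => S P w.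
by field; lra.
Qed.

(** Starting from [eis_base], two differentiations lead from exponent 2j+1 through 2j+2 to 2j+3. *)
Lemma is_sum_sym_eis (a x : R) (j : nat) : a <> 0 ->
  is_sum_sym (eis a (2 * j).+1 x) (RtoC (eis_odd a j x) * Ci)%C /\
  is_sum_sym (eis a (2 * j).+2 x) (RtoC (eis_even a j x) * Ci)%C.
Proof.
move=> ha.
have step i : (forall y, is_sum_sym (eis a (2 * i).+1 y) (RtoC (eis_odd a i y) * Ci)%C) ->
    forall y, is_sum_sym (eis a (2 * i).+2 y) (RtoC (eis_even a i y) * Ci)%C.
  by move=> h y; apply: eis_step h _ => //; exact: is_derive_eis_odd.
(* The induction treats all points [y] at once, since differentiating at a point needs the formula
   around it. *)
suff h y : is_sum_sym (eis a (2 * j).+1 y) (RtoC (eis_odd a j y) * Ci)%C.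
  by split; [exact: h | exact: step h _].
elim: j y => [|j IHj] y.
  rewrite muln0; have := eis_base a y ha.
  congr (is_sum_sym _ (RtoC _ * Ci)%C).
  rewrite /eis_odd sum_O /sech_coef ScoefTheory.Scoef_diag muln0 fact0.
  by rewrite /= /Rdiv Rinv_1 !Rmult_1_r Rmult_1_l.
have -> : (2 * j.+1 = (2 * j).+2)%nat by lia.
apply: eis_step (step j IHj) _ => //; exact: is_derive_eis_even.
Qed.

(** * Convergence of the sum over m *)

(** Taking eps = 1 bounds the tail; the finitely many other values are bounded by induction on the
    window. *)
Lemma little_o1_bounded (f : Z -> C) : little_o1 f ->
  exists B, forall m, m <> 0%Z -> Cmod (f m) <= B.
Proof.
have H (n : nat) : exists B, forall m, (Z.abs m <= Z.of_nat n)%Z -> Cmod (f m) <= B.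
  elim: n => [|n [B hB]].
    exists (Cmod (f 0%Z)) => m hm; have -> : m = 0%Z by lia.
    lra.
  exists (Rmax B (Rmax (Cmod (f (Z.of_nat n.+1))) (Cmod (f (- Z.of_nat n.+1)%Z)))) => m hm.
  have [h|[->|->]] : (Z.abs m <= Z.of_nat n)%Z \/ m = Z.of_nat n.+1 \/ m = (- Z.of_nat n.+1)%Z.
    by lia.
  - by apply: Rle_trans (hB m h) (Rmax_l _ _).
  - by apply: Rle_trans (Rmax_r _ _); exact: Rmax_l.
  - by apply: Rle_trans (Rmax_r _ _); exact: Rmax_r.
move=> /(_ 1 Rlt_0_1) [M hM]; have [B hB] := H (Z.to_nat M).
exists (Rmax B 1) => m hm.
have [h|h] : (M < Z.abs m)%Z \/ (Z.abs m <= Z.of_nat (Z.to_nat M))%Z by lia.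
  by apply: Rle_trans (Rmax_r _ _); apply: Rlt_le; exact: hM.
by apply: Rle_trans (hB m h) (Rmax_l _ _).
Qed.

Lemma cosh_ge1 (y : R) : 1 <= cosh y.
Proof. have := cosh_sqr y; have := cosh_pos y; nra. Qed.

Lemma Rabs_sinh_le_cosh (y : R) : Rabs (sinh y) <= cosh y.
Proof.
have := exp_pos y; have := exp_pos (- y) => h1 h2.
by apply: Rabs_le; rewrite /sinh /cosh; lra.
Qed.

Lemma cosh_even (y : R) : cosh (- y) = cosh y.
Proof. by rewrite /cosh Ropp_involutive Rplus_comm. Qed.

Lemma sinh_odd (y : R) : sinh (- y) = - sinh y.
Proof. by rewrite /sinh Ropp_involutive; field. Qed.

Lemma cosh_ge_exp (y : R) : exp (Rabs y) / 2 <= cosh y.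
Proof.
have := exp_pos y; have := exp_pos (- y); rewrite /cosh.
by case: (Rle_dec 0 y) => h; [rewrite Rabs_pos_eq // | rewrite Rabs_left]; lra.
Qed.

Lemma sech_geometric (w : R) (m : nat) : / cosh (INR m * w) <= 2 * exp (- Rabs w) ^ m.
Proof.
have -> : exp (- Rabs w) ^ m = / exp (Rabs (INR m * w)).
  rewrite Rabs_mult (Rabs_pos_eq (INR m)); last exact: pos_INR.
  elim: m => [|m IHm]; first by rewrite /= Rmult_0_l exp_0 Rinv_1.
  by rewrite -tech_pow_Rmult IHm S_INR -!exp_Ropp -exp_plus; congr exp; ring.
have := cosh_ge_exp (INR m * w); have h := exp_pos (Rabs (INR m * w)).
move=> h1; rewrite -[2 * _]Rinv_div; apply: Rinv_le_contravar => //; lra.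
Qed.

Lemma ex_series_sech (w : R) : w <> 0 -> ex_series (fun m : nat => / cosh (INR m.+1 * w)).
Proof.
move=> hw.
apply: (ex_series_le (V := R_CompleteNormedModule) _
          (fun m => 2 * exp (- Rabs w) * exp (- Rabs w) ^ m)).
  move=> m; rewrite /norm /= /abs /= Rabs_pos_eq -/(INR m.+1).
    by rewrite Rmult_assoc tech_pow_Rmult; exact: sech_geometric.
  by apply: Rlt_le; apply: Rinv_0_lt_compat; exact: cosh_pos.
apply: (ex_series_scal (V := R_NormedModule)); apply: ex_series_geom.
rewrite Rabs_pos_eq; last by apply: Rlt_le; exact: exp_pos.
by rewrite -exp_0; apply: exp_increasing; have := Rabs_pos_lt w hw; lra.
Qed.

Lemma ex_series_C_le (u : nat -> C) (b : nat -> R) :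
  (forall n, Cmod (u n) <= b n) -> ex_series b -> ex_series u.
Proof.
move=> h; apply: (ex_series_le (V := C_CompleteNormedModule)) => n.
by rewrite -[norm _]/(Cmod (u n)).
Qed.

Lemma is_series_C_CSeries (u : nat -> C) (l : C) : is_series u l -> CSeries u = l.
Proof.
move/filterlim_C_Cmod => h.
(* One argument serves both components: an additive real functional dominated by the modulus passes
   through the limit. *)
have HR (P : C -> R) : P 0 = 0 -> (forall x y, P (x + y)%C = P x + P y) ->
   (forall x, P (- x)%C = - P x) -> (forall x, Rabs (P x) <= Cmod x) ->
   Series (fun n => P (u n)) = P l.
  move=> P0 PD PN Ple; apply: is_series_unique.
  apply/(is_lim_seq_spec _ (P l)) => eps.
  have [N hN] := h eps (cond_pos eps); exists N => n /hN.
  have -> : sum_n (fun n => P (u n)) n = P (sum_n u n).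
    elim: n => [|n IHn]; first by rewrite !sum_O.
    by rewrite !sum_Sn IHn plusCE PD.
  by apply: Rle_lt_trans; rewrite /Rminus -PN -PD; exact: Ple.
rewrite /CSeries (HR Re) ?(HR Im) //; first by case: l {h HR}.
  by move=> x; apply: Rle_trans (Rmax_Cmod x); exact: Rmax_r.
by move=> x; apply: Rle_trans (Rmax_Cmod x); exact: Rmax_l.
Qed.

Lemma is_series_C_unique (u : nat -> C) (l l' : C) :
  is_series u l -> is_series u l' -> l = l'.
Proof. by move=> /is_series_C_CSeries <- /is_series_C_CSeries <-. Qed.

Lemma is_series_sum_n (u : nat -> nat -> C) (s : nat -> C) (n : nat) :
  (forall l, is_series (u l) (s l)) ->
  is_series (fun m => sum_n (fun l => u l m) n) (sum_n s n).
Proof.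
move=> h; elim: n => [|n IHn].
  by rewrite sum_O; apply: is_series_ext (h 0%nat) => m; rewrite sum_O.
rewrite sum_Sn; apply: is_series_ext (is_series_plus _ _ _ _ IHn (h n.+1)) => m.
by rewrite sum_Sn.
Qed.

Lemma sum_n_C_mult_l (c : C) (u : nat -> C) (n : nat) :
  sum_n (fun l => c * u l)%C n = (c * sum_n u n)%C.
Proof. exact: (sum_n_mult_l (K := C_Ring)). Qed.

Lemma sum_n_RtoC (u : nat -> R) (n : nat) :
  sum_n (fun l => RtoC (u l)) n = RtoC (sum_n u n).
Proof.
elim: n => [|n IHn]; first by rewrite !sum_O.
by rewrite !sum_Sn IHn plusCE -RtoC_plus.
Qed.

(** Common core of both formulas: [e l] has parity [s], so pairing m with -m produces f(m) + s
    f(-m), and domination by sech gives absolute convergence. *)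
Lemma iterated_sum_sech (f : Z -> C) (w B s : R) (c : nat -> R) (e : nat -> R -> R)
    (K : C) (n : nat) (F : Z -> Z -> C) (T : nat -> nat -> C) :
  w <> 0 -> Rabs s <= 1 ->
  (forall m, m <> 0%Z -> Cmod (f m) <= B) ->
  (forall l x, Rabs (e l x) <= / cosh (x * w)) ->
  (forall l x, e l (- x) = s * e l x) ->
  (forall l m, T l m = (f (Z.of_nat m) + RtoC s * f (- Z.of_nat m)%Z)
                       * RtoC (e l (INR m)))%C ->
  (forall m, m <> 0%Z -> is_sum_sym (F m)
     (f m * (K * RtoC (sum_n (fun l => c l * e l (IZR m))%R n)))%C) ->
  (forall l, (l < n.+1)%nat -> ex_series (fun m => T l m.+1)) /\
  is_iterated_sum F (K * sum_n (fun l => RtoC (c l) * CSeries (fun m => T l m.+1)) n)%C.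
Proof.
move=> hw hs hf he hodd hT hF.
have hB : 0 <= B by apply: Rle_trans (Cmod_ge_0 _) (hf 1%Z _).
have hsech := ex_series_sech w hw.
have hc y : 0 < / cosh y by apply: Rinv_0_lt_compat; exact: cosh_pos.
have exT l : ex_series (fun m => T l m.+1).
  apply: (ex_series_C_le _ (fun m => (B + B) * / cosh (INR m.+1 * w))); last first.
    exact: (ex_series_scal (V := R_NormedModule)).
  move=> m; rewrite hT Cmod_mult Cmod_R.
  apply: Rmult_le_compat; [exact: Cmod_ge_0|exact: Rabs_pos| |exact: he].
  apply: Rle_trans (Cmod_triangle _ _) _; rewrite Cmod_mult Cmod_R.
  apply: Rplus_le_compat; first by apply: hf; lia.
  rewrite -(Rmult_1_l B); apply: Rmult_le_compat => //; try exact: Cmod_ge_0.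
    exact: Rabs_pos.
  by apply: hf; lia.
split; first by move=> l _.
pose g m := (f m * (K * RtoC (sum_n (fun l => c l * e l (IZR m))%R n)))%C.
pose A := sum_n (fun l => Rabs (c l)) n.
have hg m : m <> 0%Z -> Cmod (g m) <= B * (Cmod K * A) * / cosh (IZR m * w).
  move=> hm; rewrite /g !Cmod_mult Cmod_R Rmult_assoc.
  apply: Rmult_le_compat => //; [exact: Cmod_ge_0| |exact: hf|].
    by apply: Rmult_le_pos; [exact: Cmod_ge_0 | exact: Rabs_pos].
  rewrite Rmult_assoc; apply: Rmult_le_compat_l; first exact: Cmod_ge_0.
  rewrite /A; elim: (n) => [|k IHk].
    rewrite !sum_O Rabs_mult; apply: Rmult_le_compat_l; [exact: Rabs_pos | exact: he].
  rewrite !sum_Sn; apply: Rle_trans (Rabs_triang _ _) _.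
  change plus with Rplus; rewrite Rmult_plus_distr_r; apply: Rplus_le_compat => //.
  by rewrite Rabs_mult; apply: Rmult_le_compat_l; [exact: Rabs_pos | exact: he].
have hbnd : ex_series (fun m : nat => B * (Cmod K * A) * / cosh (INR m.+1 * w)).
  exact: (ex_series_scal (V := R_NormedModule)).
have hgp m : Cmod (g (Z.of_nat m.+1)) <= B * (Cmod K * A) * / cosh (INR m.+1 * w).
  by rewrite INR_IZR_INZ; apply: hg; lia.
have hgn m : Cmod (g (- Z.of_nat m.+1)%Z) <= B * (Cmod K * A) * / cosh (INR m.+1 * w).
  (* Evenness of cosh carries the bound over to the negative half. *)
  rewrite -cosh_even -Ropp_mult_distr_l_reverse INR_IZR_INZ -opp_IZR; apply: hg; lia.
have exR (u : nat -> C) :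
    (forall m, Cmod (u m) <= B * (Cmod K * A) * / cosh (INR m.+1 * w)) ->
    ex_series (fun m => Cmod (u m)).
  move=> hu; apply: (ex_series_le (V := R_CompleteNormedModule) _ _ _ hbnd) => m.
  by rewrite /norm /= /abs /= Rabs_pos_eq; [exact: hu | exact: Cmod_ge_0].
exists g; split; first exact: hF.
split; first exact: (exR (fun m => g (Z.of_nat m.+1))).
split; first exact: (exR (fun m => g (- Z.of_nat m.+1)%Z)).
have [p hp] := ex_series_C_le _ _ hgp hbnd.
have [q hq] := ex_series_C_le _ _ hgn hbnd.
exists p, q; split=> //; split=> //.
(* Both values are sums of the series of g(m) + g(-m), so uniqueness identifies them. *)
apply: is_series_C_unique (is_series_plus _ _ _ _ hp hq).
have hl l : is_series (fun m => (RtoC (c l) * T l m.+1)%C)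
    (RtoC (c l) * CSeries (fun m => T l m.+1))%C.
  have [t ht] := exT l; rewrite (is_series_C_CSeries _ _ ht).
  exact: (is_series_scal (K := C_AbsRing) (V := C_NormedModule) _ _ _ ht).
have := is_series_scal (K := C_AbsRing) (V := C_NormedModule) K _ _
  (is_series_sum_n _ _ n hl).
apply: is_series_ext => m.
rewrite plusCE -[scal _ _]/(K * _)%C /g -!sum_n_RtoC.
have -> : sum_n (fun l => RtoC (c l * e l (IZR (- Z.of_nat m.+1)))) n =
   (RtoC s * sum_n (fun l => RtoC (c l * e l (IZR (Z.of_nat m.+1)))) n)%C.
  rewrite -sum_n_C_mult_l; apply: sum_n_ext => l.
  by rewrite opp_IZR hodd -RtoC_mult; congr RtoC; ring.
rewrite (sum_n_ext _ (fun l => (f (Z.of_nat m.+1) + RtoC s * f (- Z.of_nat m.+1)%Z)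
    * RtoC (c l * e l (IZR (Z.of_nat m.+1))))%C).
  by rewrite sum_n_C_mult_l; refine (_ : @eq C _ _); ring.
by move=> l; rewrite hT INR_IZR_INZ RtoC_mult; refine (_ : @eq C _ _); ring.
Qed.

(** * Assembly of the two formulas *)

Lemma eq_is_sum_sym (F G : Z -> C) (s : C) : (forall n, F n = G n) ->
  is_sum_sym F s -> is_sum_sym G s.
Proof. by move=> h; apply: filterlim_ext => N; exact: eq_sum_sym. Qed.

Lemma is_sum_symZ (F : Z -> C) (c s : C) :
  is_sum_sym F s -> is_sum_sym (fun n => c * F n)%C (c * s)%C.
Proof.
move=> h; have := filterlim_comp _ _ _ _ _ _ _ _ h
  (filterlim_scal_r (V := C_NormedModule) c s).
by apply: filterlim_ext => N; symmetry; exact: sum_symZ.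
Qed.

Lemma sign_pred_of_nat (l : nat) : powerRZ (-1) (Z.of_nat l - 1) = - (-1) ^ l.
Proof.
rewrite powerRZ_add; last lra.
by rewrite sign_of_nat /= Rmult_1_r; field.
Qed.

Lemma Rinv_cosh_pow_le (y : R) (q : nat) : / cosh y ^ q.+1 <= / cosh y.
Proof.
apply: Rinv_le_contravar; first exact: cosh_pos.
by have := Rle_pow (cosh y) 1 q.+1 (cosh_ge1 y) ltac:(lia); rewrite pow_1.
Qed.

Theorem theorem3p3 (f : Z -> C) (k : nat) (a : R)
    (hf : little_o1 f) (hk : (0 < k)%nat) (ha : a <> 0%R) :
  ( (forall l : nat, (l < k)%nat ->
       ex_series (fun m : nat => even_rhs_term f a l m.+1)) /\
    is_iterated_sum
      (fun m n : Z =>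
         f m * RtoC (powerRZ (-1) n)
         / (RtoC (IZR m) + RtoC (a * IZR (2 * n + 1)) * Ci) ^ (2 * k)%nat)%C
      (RtoC (PI ^ (2 * k)%nat) * Ci
       / RtoC ((2 * a) ^ (2 * k)%nat * INR (2 * k - 1)`!)
       * sum_n (fun l : nat =>
           RtoC (powerRZ (-1) (Z.of_nat l - 1)
                 * INR (2 * l + 1)`! * INR (Scoef (k - 1) l))
           * CSeries (fun m : nat => even_rhs_term f a l m.+1)) (k - 1)%nat)%C )
  /\
  ( (forall l : nat, (l < k)%nat ->
       ex_series (fun m : nat => odd_rhs_term f a l m.+1)) /\
    is_iterated_sum
      (fun m n : Z =>
         f m * RtoC (powerRZ (-1) n)
         / (RtoC (IZR m) + RtoC (a * IZR (2 * n + 1)) * Ci) ^ (2 * k - 1)%nat)%C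
      (RtoC (PI ^ (2 * k - 1)%nat) * Ci
       / RtoC ((2 * a) ^ (2 * k - 1)%nat * INR (2 * k - 2)`!)
       * sum_n (fun l : nat =>
           RtoC (powerRZ (-1) (Z.of_nat l - 1)
                 * INR (2 * l)`! * INR (Scoef (k - 1) l))
           * CSeries (fun m : nat => odd_rhs_term f a l m.+1)) (k - 1)%nat)%C ).
Proof.
(* Writing k = j+1 clears all truncated subtractions. *)
case: k hk => [//|j] _.
have -> : (2 * j.+1 - 1 = (2 * j).+1)%nat by lia.
have -> : (2 * j.+1 - 2 = 2 * j)%nat by lia.
have -> : (2 * j.+1 = (2 * j).+2)%nat by lia.
have -> : (j.+1 - 1 = j)%nat by lia.
have [B hB] := little_o1_bounded f hf.
have hPI := PI_RGT_0.
pose w := PI / (2 * a).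
have hw : w <> 0.
  by apply: Rmult_integral_contrapositive; split; [lra | apply: Rinv_neq_0_compat; lra].
have hxw x : x * PI / (2 * a) = x * w by rewrite /w /Rdiv; ring.
have hsum p m s : is_sum_sym (eis a p (IZR m)) s ->
    is_sum_sym (fun n : Z => f m * RtoC (powerRZ (-1) n)
         / (RtoC (IZR m) + RtoC (a * IZR (2 * n + 1)) * Ci) ^ p)%C (f m * s)%C.
  move/(is_sum_symZ _ (f m)); apply: eq_is_sum_sym => n.
  by rewrite /eis /pole /Cdiv; ring.
(* The leading minus sign of [eis_odd] and [eis_even] accounts for (-1)^(l-1) against the (-1)^l of
   [sech_coef]. *)
have hneg (x y S : R) : - x / y * (-1 * S) = x / y * S by rewrite /Rdiv; ring.
have hconst (q r : nat) (S : R) : (RtoC (PI ^ q) * Ci / RtoC ((2 * a) ^ q * INR r`!) * RtoC S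
    = RtoC (w ^ q / INR r`! * S) * Ci)%C.
  have h2 : (2 * a) ^ q <> 0 by apply: pow_nonzero; lra.
  have h3 := INR_fact_pos r.
  have -> : w ^ q / INR r`! * S = PI ^ q * / ((2 * a) ^ q * INR r`!) * S.
    have -> : w ^ q = PI ^ q * / (2 * a) ^ q by rewrite -pow_inv -Rpow_mult_distr.
    by field; split=> //; lra.
  rewrite /Cdiv -RtoC_inv; first by rewrite !RtoC_mult; ring.
  by apply: Rmult_integral_contrapositive; split=> //; lra.
split.
(* Here s = -1, because sinh is odd. *)
- apply: (iterated_sum_sech f w B (-1)
    (fun l => powerRZ (-1) (Z.of_nat l - 1) * INR (2 * l + 1)`! * INR (Scoef j l))
    (fun l x => sinh (x * PI / (2 * a)) / cosh (x * PI / (2 * a)) ^ (2 * l + 2)%nat)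
    (RtoC (PI ^ (2 * j).+2) * Ci / RtoC ((2 * a) ^ (2 * j).+2 * INR ((2 * j).+1)`!))%C
    j _ (even_rhs_term f a) hw _ hB).
  + by rewrite Rabs_Ropp Rabs_R1; lra.
  + move=> l x; rewrite hxw addn2 /Rdiv Rabs_mult Rabs_inv.
    have hc := cosh_pos (x * w).
    rewrite (Rabs_pos_eq (_ ^ _)); last by apply: pow_le; lra.
    (* One factor of sech is spent on |sinh| <= cosh, leaving sech^(2l+1) <= sech. *)
    rewrite -tech_pow_Rmult Rinv_mult -Rmult_assoc -[X in _ <= X]Rmult_1_l.
    apply: Rmult_le_compat; last exact: Rinv_cosh_pow_le.
    * apply: Rmult_le_pos; first exact: Rabs_pos.
      by apply: Rlt_le; exact: Rinv_0_lt_compat.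
    * by apply: Rlt_le; apply: Rinv_0_lt_compat; exact: pow_lt.
    * by apply/(Rle_div_l _ _ (cosh (x * w))) => //; rewrite Rmult_1_l; exact: Rabs_sinh_le_cosh.
  + move=> l x; rewrite !hxw Ropp_mult_distr_l_reverse cosh_even sinh_odd /Rdiv; ring.
  + move=> l m; rewrite /even_rhs_term (RtoC_div (sinh _) (_ ^ _)); first by rewrite /Cdiv; ring.
    by apply: pow_nonzero; have := cosh_pos (INR m * PI / (2 * a)); lra.
  + move=> m _; apply: hsum; rewrite hconst; cbv beta.
    have [_] := is_sum_sym_eis a (IZR m) j ha.
    congr (is_sum_sym _ (RtoC _ * Ci)%C); rewrite /eis_even -/w.
    rewrite (sum_n_ext _ (fun l => mult (-1) (powerRZ (-1) (Z.of_nat l - 1)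
       * INR (2 * l + 1)`! * INR (Scoef j l)
       * (sinh (IZR m * PI / (2 * a)) / cosh (IZR m * PI / (2 * a)) ^ (2 * l + 2)%nat)))).
      by rewrite sum_n_mult_l; exact: hneg.
    (* The identity (2l+1)! = (2l+1) (2l)! supplies the factor 2l+1 of [eis_even]. *)
    move=> l; rewrite sign_pred_of_nat /sech_coef addn1 addn2 INR_factS S_INR INR_double.
    by change mult with Rmult; refine (_ : @eq R _ _); ring.
(* Here s = 1, because powers of sech are even. *)
- apply: (iterated_sum_sech f w B 1
    (fun l => powerRZ (-1) (Z.of_nat l - 1) * INR (2 * l)`! * INR (Scoef j l))
    (fun l x => / cosh (x * PI / (2 * a)) ^ (2 * l + 1)%nat)
    (RtoC (PI ^ (2 * j).+1) * Ci / RtoC ((2 * a) ^ (2 * j).+1 * INR (2 * j)`!))%C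
    j _ (odd_rhs_term f a) hw _ hB).
  + by rewrite Rabs_R1; lra.
  + move=> l x; rewrite hxw addn1 Rabs_inv Rabs_pos_eq; first exact: Rinv_cosh_pow_le.
    by apply: pow_le; have := cosh_pos (x * w); lra.
  + by move=> l x; rewrite !hxw Ropp_mult_distr_l_reverse cosh_even Rmult_1_l.
  + move=> l m; rewrite /odd_rhs_term (RtoC_inv (_ ^ _)); first by rewrite /Cdiv; ring.
    by apply: pow_nonzero; have := cosh_pos (INR m * PI / (2 * a)); lra.
  + move=> m _; apply: hsum; rewrite hconst; cbv beta.
    have [+ _] := is_sum_sym_eis a (IZR m) j ha.
    congr (is_sum_sym _ (RtoC _ * Ci)%C); rewrite /eis_odd -/w.
    rewrite (sum_n_ext _ (fun l => mult (-1) (powerRZ (-1) (Z.of_nat l - 1)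
       * INR (2 * l)`! * INR (Scoef j l)
       * / cosh (IZR m * PI / (2 * a)) ^ (2 * l + 1)%nat))).
      by rewrite sum_n_mult_l; exact: hneg.
    move=> l; rewrite sign_pred_of_nat /sech_coef addn1.
    by change mult with Rmult; refine (_ : @eq R _ _); ring.
Qed.
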